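(* Let data $(x_i,y_i)$, $i=1,\dots,n$, with $x_i\in\mathbb{R}^p$ and $y_i\in\mathbb{R}$ be given, let $C$ be a cost parameter and $\epsilon$ the cutoff of the $\epsilon$-insensitive loss function. If $(\hat\alpha,\hat\alpha^* )$ is the solution to the standard support vector regression (SVR) problem $$\min_{\alpha,\alpha^*}\Big(\epsilon\sum_i(\alpha_i^*+\alpha_i)-\sum_iy_i(\alpha_i^*-\alpha_i)+\frac12\sum_i\sum_j(\alpha_i^*-\alpha_i)(\alpha_j^*-\alpha_j)\langle x_i,x_j\rangle\Big)$$ subject to $$0\le\alpha_i,\alpha_i^*\le C,\qquad\sum_i(\alpha_i^*-\alpha_i)=0,\qquad\alpha_i\alpha_i^*=0\ \ \forall i,$$ then $(\hat\alpha^*,\hat\alpha)$ is the solution of the SVR problem on the data where the signs of all responses were switched, i.e. on $(x_i,-y_i)$, $i=1,\dots,n$.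
   Context: Here $\alpha=(\alpha_1,\dots,\alpha_n)$ and $\alpha^*=(\alpha_1^*,\dots,\alpha_n^* )$ are vectors in $\mathbb{R}^n$, and the pair $(\hat\alpha^*,\hat\alpha)$ means that the first argument $\alpha$ takes the value $\hat\alpha^*$ and the second argument $\alpha^*$ takes the value $\hat\alpha$. *)

(* Defs.v *)
From mathcomp Require Import all_boot all_order all_algebra.
From mathcomp Require Import reals.

Set Implicit Arguments.
Unset Strict Implicit.
Unset Printing Implicit Defensive.

Import Order.TTheory GRing.Theory Num.Theory.
Local Open Scope ring_scope.

Definition inner (R : realType) (p : nat) (u v : 'rV[R]_p) : R :=
  \sum_(k < p) u 0 k * v 0 k.

(* In [svr_objective], [svr_feasible] and [svr_solution] the first dual vector
   is alpha and the second one is alpha^*; the order matters. *)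

Definition svr_objective (R : realType) (n p : nat)
    (x : 'I_n -> 'rV[R]_p) (y : 'I_n -> R) (eps : R)
    (alpha alphas : 'rV[R]_n) : R :=
  eps * (\sum_(i < n) (alphas 0 i + alpha 0 i))
  - \sum_(i < n) y i * (alphas 0 i - alpha 0 i)
  + 2^-1 * \sum_(i < n) \sum_(j < n)
      (alphas 0 i - alpha 0 i) * (alphas 0 j - alpha 0 j) * inner (x i) (x j).

Definition svr_feasible (R : realType) (n : nat) (C : R)
    (alpha alphas : 'rV[R]_n) : Prop :=
  [/\ forall i, 0 <= alpha 0 i <= C,
      forall i, 0 <= alphas 0 i <= C,
      \sum_(i < n) (alphas 0 i - alpha 0 i) = 0
    & forall i, alpha 0 i * alphas 0 i = 0].

(* Global minimizers; there may be several, e.g. when some of the x_i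
   coincide. *)
Definition svr_solution (R : realType) (n p : nat)
    (x : 'I_n -> 'rV[R]_p) (y : 'I_n -> R) (C eps : R)
    (a : 'rV[R]_n * 'rV[R]_n) : Prop :=
  svr_feasible C a.1 a.2 /\
  forall b : 'rV[R]_n * 'rV[R]_n, svr_feasible C b.1 b.2 ->
    svr_objective x y eps a.1 a.2 <= svr_objective x y eps b.1 b.2.

(* Main.v *)
Require Import Defs.
From mathcomp Require Import all_boot all_order all_algebra.
From mathcomp Require Import reals.

Set Implicit Arguments.
Unset Strict Implicit.
Unset Printing Implicit Defensive.

Import Order.TTheory GRing.Theory Num.Theory.
Local Open Scope ring_scope.

(** Exchanging the two dual vectors negates every difference $\alpha_i^*-\alpha_i$. In the linear
    term this cancels the sign switch of $y$, in the quadratic term the two signs cancel, and the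
    $\epsilon$ term is symmetric. The constraints are symmetric too, so the exchange is an
    involution matching the two problems with equal objective values. *)

Lemma svr_objective_swap (R : realType) (n p : nat)
    (x : 'I_n -> 'rV[R]_p) (y : 'I_n -> R) (eps : R) (a b : 'rV[R]_n) :
  svr_objective x (fun i => - y i) eps b a = svr_objective x y eps a b.
Proof.
rewrite /svr_objective; congr (_ * _ - _ + _ * _).
- by apply: eq_bigr => i _; rewrite addrC.
- by apply: eq_bigr => i _; rewrite mulNr -mulrN opprB.
- apply: eq_bigr => i _; apply: eq_bigr => j _; congr (_ * _).
  by rewrite -mulrNN !opprB.
Qed.

Lemma svr_feasible_swap (R : realType) (n : nat) (C : R) (a b : 'rV[R]_n) :
  svr_feasible C a b -> svr_feasible C b a.
Proof.
case=> ha hb hsum hprod; split=> // [|i]; last by rewrite mulrC.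
apply: oppr_inj; rewrite oppr0 -[RHS]hsum -sumrN.
by apply: eq_bigr => i _; rewrite opprB.
Qed.

(** An equivalence, since uniqueness also needs minimizers carried back from the switched
    problem. *)
Lemma svr_solution_swap (R : realType) (n p : nat)
    (x : 'I_n -> 'rV[R]_p) (y : 'I_n -> R) (C eps : R) (a b : 'rV[R]_n) :
  svr_solution x (fun i => - y i) C eps (b, a) <->
  svr_solution x y C eps (a, b).
Proof.
split=> -[/= /svr_feasible_swap hfeas hmin]; split=> //= -[c d] /= hcd.
(* A competitor [(c, d)] is tested through its mirror image [(d, c)]. *)
- have /= := hmin (d, c) (svr_feasible_swap hcd).
  by rewrite !svr_objective_swap.
- by rewrite !svr_objective_swap; apply: (hmin (d, c)); apply: svr_feasible_swap.
Qed.

(** The two conjuncts cover both readings of being the solution: a minimizer, or the only one. *)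
Theorem lemma9p1 (R : realType) (n p : nat)
    (x : 'I_n -> 'rV[R]_p) (y : 'I_n -> R) (C eps : R)
    (ahat ahats : 'rV[R]_n) :
  (svr_solution x y C eps (ahat, ahats) ->
     svr_solution x (fun i => - y i) C eps (ahats, ahat)) /\
  (unique (svr_solution x y C eps) (ahat, ahats) ->
     unique (svr_solution x (fun i => - y i) C eps) (ahats, ahat)).
Proof.
split=> [/svr_solution_swap //|[/svr_solution_swap hsol huniq]].
by split=> // -[c d] /svr_solution_swap /huniq [-> ->].
Qed.
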